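(* Suppose that $S$ is a positive normal affine semigroup and $\xi=(\xi_1,\dots,\xi_n): S\to \mathbb{Z}_+^n$ a pure embedding. Let $K$ be a field, $R=K[S]$, $\sigma_1,\dots,\sigma_s$ the support forms of $S$ ($s=\#\operatorname{supp}(S)$), and $Q=K[X_1,\dots,X_n]$. Then the following are equivalent: \begin{itemize} \item[(a)] every non-zero coset module $Q_z$ of $\xi(S)$, $z\in\mathbb{Z}^n/\xi(\operatorname{gp}(S))$, is divisorial (i.e. isomorphic as an $R$-module to a divisorial ideal of $R$); \item[(b)] for each $i=1,\dots,n$ there exist $j_i\in \{1,\dots,s\}$ and $e_i\in\mathbb{Z}_+$ with $\xi_i=e_i\sigma_{j_i}$. \end{itemize}
   Context: Semigroups are commutative, written additively, with $0$. An affine semigroup is a finitely generated subsemigroup of some $\mathbb{Z}^m$; $\operatorname{gp}(S)$ is its group of differences; $S$ is normal if every $x\in\operatorname{gp}(S)$ with $mx\in S$ for some integer $m>0$ lies in $S$, and positive if $0$ is its only invertible element. Identify $\operatorname{gp}(S)=\mathbb{Z}^r$ and let $C(S)\subset\mathbb{R}^r$ be the cone generated by $S$. The support forms $\sigma_1,\dots,\sigma_s$ are the (unique up to order) linear forms on $\mathbb{R}^r$ with coprime integer coefficients such that $C(S)=\{x:\sigma_i(x)\ge0,\ i=1,\dots,s\}$ is an irredundant representation, and $\operatorname{supp}(S)=\{\sigma_1,\dots,\sigma_s\}$. An injective homomorphism $\xi:S\to\mathbb{Z}_+^n$ is a pure embedding if $\xi(S)=\mathbb{Z}_+^n\cap\operatorname{gp}(\xi(S))$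 in $\mathbb{Z}^n$; its components $\xi_i$ are extended to linear forms on $\operatorname{gp}(S)$. Via $\xi$, $R$ is regarded as a subring of $Q=K[\mathbb{Z}_+^n]$. For $z\in\mathbb{Z}^n/\xi(\operatorname{gp}(S))$ the coset module $Q_z$ is the $R$-submodule of $Q$ spanned over $K$ by all monomials whose exponent vector has residue class $-z$; thus $Q=\bigoplus_z Q_z$. A divisorial ideal is a reflexive fractional ideal of the normal domain $R$.
   Formalization: The semigroup S is assumed to be different from {0}: for S = {0} and n ≥ 1 there are no support forms, so (b) fails, while (a) holds because every non-zero coset module is isomorphic to R = K. *)

(* Defs.v *)
From HB Require Import structures.
From mathcomp Require Import all_boot all_order all_algebra.
From mathcomp Require Import fraction finmap monalg.
From mathcomp Require Import boolp classical_sets functions reals.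

Set Implicit Arguments.
Unset Strict Implicit.
Unset Printing Implicit Defensive.

Import Order.TTheory GRing.Theory Num.Theory.

Local Open Scope classical_set_scope.
Local Open Scope ring_scope.

Definition gp (V : zmodType) (A : set V) : set V :=
  [set x - y | x in A & y in A].

Definition finitely_generated (V : zmodType) (A : set V) : Prop :=
  exists (l : nat) (g : 'I_l -> V),
    A = [set \sum_(i < l) g i *+ c i | c in [set: 'I_l -> nat]].

Definition positive_semigroup (V : zmodType) (A : set V) : Prop :=
  forall x, A x -> A (- x) -> x = 0.

Definition normal_semigroup (V : zmodType) (A : set V) : Prop :=
  forall x, gp A x -> forall k : nat, (0 < k)%N -> A (x *+ k) -> A x.

(* Positivity is bundled because [monomType], the index type of a monoid      *)
(* algebra [{malg K[M]}], only allows monoids without non-trivial units.      *)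
Record posAffineSemigroup (m : nat) := PosAffineSemigroup {
  semigroup_set :> set 'rV[int]_m;
  semigroup_fg : finitely_generated semigroup_set;
  semigroup_pos : positive_semigroup semigroup_set
}.

Section SemigroupElements.
Variables (m : nat) (S : posAffineSemigroup m).

Definition semigroup_elt : Type := {x : 'rV[int]_m | x \in semigroup_set S}.

HB.instance Definition _ := SubChoice.on semigroup_elt.

Implicit Types x y z : semigroup_elt.

Lemma semigroup0 : 0 \in semigroup_set S.
Proof.
have [l [g ->]] := semigroup_fg S; rewrite inE; exists (fun=> 0%N) => //=.
by rewrite big1 // => i _; rewrite mulr0n.
Qed.

Lemma semigroupD (x y : 'rV[int]_m) : x \in semigroup_set S ->
  y \in semigroup_set S -> x + y \in semigroup_set S.
Proof.
have [l [g ->]] := semigroup_fg S; rewrite !inE.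
move=> [c _ <-] [d _ <-]; exists (fun i => c i + d i)%N => //=.
by rewrite -big_split /=; apply: eq_bigr => i _; rewrite mulrnDr.
Qed.

Definition semigroup_zero : semigroup_elt := exist _ 0 semigroup0.

Definition semigroup_add x y : semigroup_elt :=
  exist _ (val x + val y) (semigroupD (valP x) (valP y)).

Lemma semigroup_addA : associative semigroup_add.
Proof. by move=> x y z; apply: val_inj; rewrite /= addrA. Qed.

Lemma semigroup_addC : commutative semigroup_add.
Proof. by move=> x y; apply: val_inj; rewrite /= addrC. Qed.

Lemma semigroup_add0 : left_id semigroup_zero semigroup_add.
Proof. by move=> x; apply: val_inj; rewrite /= add0r. Qed.

Lemma semigroup_addr0 : right_id semigroup_zero semigroup_add.
Proof. by move=> x; apply: val_inj; rewrite /= addr0. Qed.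

Lemma semigroup_unit x y : semigroup_add x y = semigroup_zero ->
  x = semigroup_zero /\ y = semigroup_zero.
Proof.
move=> /(congr1 val) /= xy0.
have x0 : x = semigroup_zero.
  apply: val_inj; apply: (@semigroup_pos _ S); first exact/set_mem/(valP x).
  by rewrite (addr0_eq xy0); exact/set_mem/(valP y).
by split=> //; apply: val_inj; move: xy0; rewrite x0 add0r.
Qed.

HB.instance Definition _ := Choice_isMonomialDef.Build semigroup_elt
  semigroup_addA semigroup_add0 semigroup_addr0 semigroup_unit.
HB.instance Definition _ :=
  MonomialDef_isConomialDef.Build semigroup_elt semigroup_addC.

End SemigroupElements.

(* The semigroup ring is an integral domain: a lexicographic order on the   *)
(* ambient lattice yields leading terms.                                    *)

Section LexPositive.
Variable m : nat.
Implicit Types x y : 'rV[int]_m.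

Let lexpos x := exists i : 'I_m,
  0 < x 0 i /\ forall j : 'I_m, (j < i)%N -> x 0 j = 0.

Let lexpos0 : ~ lexpos 0.
Proof. by case=> i []; rewrite mxE ltxx. Qed.

Let lexposD x y : lexpos x -> lexpos y -> lexpos (x + y).
Proof.
move=> [i [xi x0]] [j [yj y0]]; case: (ltngtP i j) => [ij|ji|/val_inj eij].
- exists i; split; first by rewrite mxE (y0 _ ij) addr0.
  by move=> k ki; rewrite mxE x0 // y0 ?addr0 // (ltn_trans ki).
- exists j; split; first by rewrite mxE (x0 _ ji) add0r.
  by move=> k kj; rewrite mxE y0 // x0 ?addr0 // (ltn_trans kj).
- exists i; split; first by rewrite mxE addr_gt0 // eij.
  by move=> k ki; rewrite mxE x0 // y0 ?addr0 // -eij.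
Qed.

Let lexpos_total x : x != 0 -> lexpos x \/ lexpos (- x).
Proof.
move=> x0; have [i0 xi0] : exists i, x 0 i != 0.
  apply/existsP; apply: contraNT x0; rewrite negb_exists => /forallP x0.
  by apply/eqP/rowP => i; rewrite mxE; apply/eqP; move: (x0 i); rewrite negbK.
case: (@arg_minnP _ i0 (fun i => x 0 i != 0) (fun i => i : nat) xi0) => i xi mi.
have x0j (j : 'I_m) : (j < i)%N -> x 0 j = 0.
  by move=> ji; apply/eqP; apply: contraTT ji => /mi; rewrite -leqNgt.
case: (ltrgtP (x 0 i) 0) xi => // xi _; [right|left]; exists i; split=> //.
  by rewrite mxE oppr_gt0.
by move=> j ji; rewrite mxE x0j // oppr0.
Qed.

Lemma lex_max (T : choiceType) (f : T -> 'rV[int]_m) : injective f ->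
  forall (s : seq T) (t0 : T), t0 \in s ->
  exists2 t, t \in s & forall t', t' \in s -> t' != t -> lexpos (f t - f t').
Proof.
move=> fI; elim=> // a s IH t0 _.
case: s IH => [_|b s IH].
  by exists a => [|t']; rewrite !inE // => ->.
have [t ts tmax] := IH b (mem_head _ _).
have [eat|nat] := eqVneq a t.
  exists t; first by rewrite inE ts orbT.
  by move=> t'; rewrite inE => /orP[/eqP->|]; [rewrite eat eqxx|exact: tmax].
have : f t - f a != 0 by rewrite subr_eq0 (inj_eq fI) eq_sym.
move=> /lexpos_total[ta|]; last rewrite opprB => ta.
  exists t; first by rewrite inE ts orbT.
  by move=> t'; rewrite inE => /orP[/eqP->//|]; exact: tmax.
exists a; first by rewrite mem_head.
move=> t'; rewrite inE => /orP[/eqP->|t's _]; first by rewrite eqxx.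
have [->//|t't] := eqVneq t' t.
by rewrite -(subrKA (f t)); apply: lexposD => //; exact: tmax.
Qed.

Lemma lex_sum_uniq (T : choiceType) (f : T -> 'rV[int]_m) : injective f ->
  forall (s1 s2 : seq T) (t1 t2 u1 u2 : T),
  (forall t', t' \in s1 -> t' != t1 -> lexpos (f t1 - f t')) ->
  (forall t', t' \in s2 -> t' != t2 -> lexpos (f t2 - f t')) ->
  u1 \in s1 -> u2 \in s2 -> f u1 + f u2 = f t1 + f t2 -> u1 = t1 /\ u2 = t2.
Proof.
move=> fI s1 s2 t1 t2 u1 u2 m1 m2 us1 us2 e.
have e0 : (f t1 - f u1) + (f t2 - f u2) = 0.
  by rewrite addrACA -e -opprD subrr.
have [e1|n1] := eqVneq u1 t1.
  by split=> //; apply: fI; move: e; rewrite e1 => /addrI.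
have [e2|n2] := eqVneq u2 t2.
  by split=> //; apply: fI; move: e; rewrite e2 => /addIr.
by case: lexpos0; rewrite -e0; apply: lexposD; [exact: m1|exact: m2].
Qed.

End LexPositive.

Section SemigroupRing.
Variables (K : fieldType) (m : nat) (S : posAffineSemigroup m).

Definition semigroup_ring : Type := {malg K[semigroup_elt S]}.

HB.instance Definition _ := GRing.ComAlgebra.on semigroup_ring.

Implicit Types p q : semigroup_ring.

Lemma semigroup_ring_integral p q : p * q = 0 -> (p == 0) || (q == 0).
Proof.
move=> pq0; apply/negP => /negP; rewrite negb_or => /andP[p0 q0].
have supp0 (g : {malg K[semigroup_elt S]}) : g != 0 -> exists k, k \in msupp g.
  by move=> g0; apply/fset0Pn; rewrite msupp_eq0.
have [k1 /(lex_max val_inj)[{}k1 k1p m1]] := supp0 _ p0.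
have [k2 /(lex_max val_inj)[{}k2 k2q m2]] := supp0 _ q0.
have : (p * q : {malg K[semigroup_elt S]})@_(mmul k1 k2) = p@_k1 * q@_k2.
  have U := lex_sum_uniq val_inj m1 m2.
  have z1 i : i \in msupp (p : {malg K[semigroup_elt S]}) -> i != k1 ->
      \sum_(j <- msupp (q : {malg K[semigroup_elt S]}))
        (p@_i * q@_j) *+ (mmul i j == mmul k1 k2) = 0.
    move=> ip ik1; apply: big1_seq => j /andP[_ jq].
    case: eqP => // /(congr1 val) /= e; have [ei _] := U _ _ ip jq e.
    by rewrite ei eqxx in ik1.
  have z2 j : j \in msupp (q : {malg K[semigroup_elt S]}) -> j != k2 ->
      (p@_k1 * q@_j) *+ (mmul k1 j == mmul k1 k2) = 0.
    move=> jq jk2; case: eqP => // /(congr1 val) /= e.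
    by have [_ ej] := U _ _ k1p jq e; rewrite ej eqxx in jk2.
  rewrite (mcoeffMl (p : {malg K[semigroup_elt S]}) q).
  rewrite (big_fsetD1 k1 k1p) (big_fsetD1 k2 k2q) eqxx mulr1n.
  have add00 (a b c : K) : b = 0 -> c = 0 -> (a + b) + c = a.
    by move=> -> ->; rewrite !addr0.
  apply: add00; apply: big1_seq => j /andP[_].
    by rewrite in_fsetD1 => /andP[jk2 jq]; exact: z2.
  by rewrite in_fsetD1 => /andP[jk1 jp]; exact: z1.
rewrite pq0 mcoeff0 => /esym/eqP; rewrite mulf_eq0.
by rewrite !mcoeff_eq0 k1p k2q.
Qed.

Let unit : pred semigroup_ring := fun p => `[< exists q, q * p = 1 >].

Let inv p : semigroup_ring :=
  if pselect (exists q, q * p = 1) is left e then projT1 (cid e) else p.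

Let invP : {in unit, left_inverse 1 inv *%R}.
Proof.
by move=> p /asboolP e; rewrite /inv; case: pselect => // h; case: cid.
Qed.

Let unitP p q : q * p = 1 -> unit p.
Proof. by move=> e; apply/asboolP; exists q. Qed.

Let inv_out : {in [predC unit], inv =1 id}.
Proof. by move=> p /asboolP e; rewrite /inv; case: pselect. Qed.

HB.instance Definition _ := GRing.ComNzRing_hasMulInverse.Build semigroup_ring
  invP unitP inv_out.
HB.instance Definition _ :=
  GRing.ComUnitRing_isIntegral.Build semigroup_ring semigroup_ring_integral.

End SemigroupRing.

Definition lform (A : pzRingType) (r : nat) (c : 'rV[int]_r) (x : 'rV[A]_r)
  : A := \sum_(k < r) x 0 k *~ c 0 k.

Definition conical_hull (RR : realType) (r : nat) (X : set 'rV[RR]_r)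
  : set 'rV[RR]_r :=
  [set x | exists (l : nat) (a : 'I_l -> RR) (v : 'I_l -> 'rV[RR]_r),
    [/\ forall i, 0 <= a i, forall i, X (v i) & x = \sum_(i < l) a i *: v i]].

(* [phi] is the chosen identification of [Z^r] with [gp S]; linear forms on    *)
(* [R^r] with integer coefficients are given by their coefficient vectors.    *)
Definition semigroup_cone (RR : realType) (m r : nat) (S : set 'rV[int]_m)
  (phi : 'rV[int]_r -> 'rV[int]_m) : set 'rV[RR]_r :=
  conical_hull [set map_mx intr u | u in phi @^-1` S].

Arguments semigroup_cone RR {m r} S phi.

Definition support_forms (RR : realType) (m r s : nat) (S : set 'rV[int]_m)
  (phi : 'rV[int]_r -> 'rV[int]_m) (sigma : 'I_s -> 'rV[int]_r) : Prop :=
  [/\ forall i, \big[gcdn/0%N]_(k < r) `|sigma i ord0 k|%N = 1%N,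
      semigroup_cone RR S phi = [set x | forall i, 0 <= lform (sigma i) x]
    & forall i0, semigroup_cone RR S phi <>
        [set x | forall i, i != i0 -> 0 <= lform (sigma i) x]].

Definition restrict_scalars (R A : comNzRingType) (f : {rmorphism R -> A})
  : Type := A.

Section RestrictScalars.
Variables (R A : comNzRingType) (f : {rmorphism R -> A}).
Local Notation M := (restrict_scalars f).

HB.instance Definition _ := GRing.Zmodule.on M.

Let scale (a : R) (x : M) : M := f a * (x : A).

Let scaleA a b x : scale a (scale b x) = scale (a * b) x.
Proof. by rewrite /scale rmorphM mulrA. Qed.

Let scale1 : left_id 1 scale.
Proof. by move=> x; rewrite /scale rmorph1 mul1r. Qed.

Let scaleDr : right_distributive scale +%R.
Proof. by move=> a x y; rewrite /scale mulrDr. Qed.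

Let scaleDl x : {morph scale^~ x : a b / a + b}.
Proof. by move=> a b; rewrite /scale rmorphD mulrDl. Qed.

HB.instance Definition _ :=
  GRing.Zmodule_isLmodule.Build R M scaleA scale1 scaleDr scaleDl.

Lemma restrict_scaleE (a : R) (x : M) : a *: x = f a * (x : A) :> A.
Proof. by []. Qed.

End RestrictScalars.

Record submodule (R : nzRingType) (U : lmodType R) := Submodule {
  submodule_set :> set U;
  submodule_closed : submodule_set 0 /\ forall (a : R) (u v : U),
    submodule_set u -> submodule_set v -> submodule_set (a *: u + v)
}.

Section SubmoduleElements.
Variables (R : nzRingType) (U : lmodType R) (N : submodule U).

Definition submodule_elt : Type := {x : U | x \in submodule_set N}.

HB.instance Definition _ := SubChoice.on submodule_elt.

Lemma submodule_subsemimod_closed :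
  GRing.subsemimod_closed [pred x : U | x \in submodule_set N].
Proof.
have [N0 NL] := submodule_closed N; split; first split.
- exact/mem_set.
- by move=> x y /set_mem Nx /set_mem Ny; apply/mem_set;
    rewrite -[x]scale1r; exact: NL.
- by move=> a x /set_mem Nx; apply/mem_set; rewrite -[_ *: _]addr0; exact: NL.
Qed.

HB.instance Definition _ := GRing.SubChoice_isSubLmodule.Build R U
  [pred x : U | x \in submodule_set N] submodule_elt
  submodule_subsemimod_closed.

End SubmoduleElements.

Section Dual.
Variable R : comNzRingType.

Lemma linear_forms_closed (M : lmodType R) :
  let L := [set f : M -> R^o | linear f] in
  L 0 /\ forall (a : R) (f g : M -> R^o), L f -> L g -> L (a *: f + g).
Proof.
split=> [a u v|b f g fL gL a u v].
  by change (0 = a *: 0 + 0 :> R^o); rewrite scaler0 addr0.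
change (b *: f (a *: u + v) + g (a *: u + v) =
  a *: (b *: f u + g u) + (b *: f v + g v) :> R^o).
rewrite fL gL !scalerDr !scalerA [b * a]mulrC.
by rewrite -!addrA; congr (_ + _); rewrite addrCA.
Qed.

Definition linear_forms (M : lmodType R) : submodule (M -> R^o) :=
  Submodule (linear_forms_closed M).

Definition dual (M : lmodType R) : lmodType R :=
  submodule_elt (linear_forms M).

Lemma bidual_eval_linear (M : lmodType R) (x : M) :
  (fun f : dual M => sval f x) \in submodule_set (linear_forms (dual M)).
Proof. by apply/mem_set => a f g. Qed.

Definition bidual_eval (M : lmodType R) (x : M) : dual (dual M) :=
  exist _ (fun f : dual M => sval f x) (bidual_eval_linear x)
    : submodule_elt (linear_forms (dual M)).

Definition reflexive_module (M : lmodType R) : Prop :=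
  bijective (@bidual_eval M).

Definition isomorphic_modules (M N : lmodType R) : Prop :=
  exists f : {linear M -> N}, bijective f.

End Dual.

Section DivisorialIdeals.
Variable R : idomainType.

Definition frac_module : lmodType R := restrict_scalars (@tofrac R).

Definition fractional_ideal (I : submodule frac_module) : Prop :=
  (exists2 x, submodule_set I x & x <> 0) /\
  (exists2 d : R, d != 0 &
     forall x, submodule_set I x -> exists a : R, d *: x = tofrac a).

Definition divisorial_ideal (I : submodule frac_module) : Prop :=
  fractional_ideal I /\ reflexive_module (submodule_elt I).

Definition divisorial_module (M : lmodType R) : Prop :=
  exists2 I : submodule frac_module, divisorial_ideal I
    & isomorphic_modules M (submodule_elt I).

End DivisorialIdeals.

(* ['X_{1..n}] is [Z_+^n], written multiplicatively in the library; it is the *)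
(* monoid of exponent vectors of [{mpoly K[n]} = {malg K['X_{1..n}]}].        *)
Definition exponent (n : nat) (a : 'X_{1..n}) : 'rV[int]_n :=
  \row_(i < n) (a i)%:Z.

Record pureEmbedding (m n : nat) (S : posAffineSemigroup m) := PureEmbedding {
  embedding :> semigroup_elt S -> 'X_{1..n};
  embedding0 : embedding mone = mone;
  embeddingD : {morph embedding : x y / mmul x y};
  embedding_inj : injective embedding;
  embedding_pure : range embedding =
    [set a | gp [set exponent b | b in range embedding] (exponent a)]
}.

Section CosetModules.
Variables (K : fieldType) (m n : nat) (S : posAffineSemigroup m).
Variable xi : pureEmbedding n S.

Definition embedding_gp : set 'rV[int]_n :=
  gp [set exponent a | a in range xi].

(* The elements of the quotient group [Z^n / gp(xi(S))]. *)
Record embedding_coset := EmbeddingCoset {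
  coset_set :> set 'rV[int]_n;
  coset_setP : exists v, coset_set = [set v + g | g in embedding_gp]
}.

Let monomial (s : semigroup_elt S) : {mpoly K[n]} := << xi s >>.

Let monomial_mmorphism : mmorphism monomial.
Proof.
split=> [x y|]; rewrite /monomial ?embedding0 // embeddingD.
by rewrite malgM_def fgmulUU mulr1.
Qed.

HB.instance Definition _ := isMultiplicative.Build (semigroup_elt S) {mpoly K[n]} monomial
  monomial_mmorphism.

(* The inclusion [K[S] -> K[X_1, ..., X_n]] induced by [xi]. *)
Definition embedding_ring (p : semigroup_ring K S) : {mpoly K[n]} :=
  mmap malgC (fun s : semigroup_elt S => << xi s >> : {mpoly K[n]}) p.

Let embedding_ring_zmod : zmod_morphism embedding_ring.
Proof. exact: (raddfB (mmap malgC monomial)). Qed.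

Let embedding_ring_monoid : monoid_morphism embedding_ring.
Proof.
by split; [exact: (rmorph1 (mmap malgC monomial))
          |exact: (rmorphM (mmap malgC monomial))].
Qed.

HB.instance Definition _ := GRing.isZmodMorphism.Build
  (semigroup_ring K S) {mpoly K[n]} embedding_ring embedding_ring_zmod.
HB.instance Definition _ := GRing.isMonoidMorphism.Build
  (semigroup_ring K S) {mpoly K[n]} embedding_ring embedding_ring_monoid.

Definition polynomial_module : lmodType (semigroup_ring K S) :=
  restrict_scalars embedding_ring.

Definition coset_module_set (z : embedding_coset) : set polynomial_module :=
  [set q : {mpoly K[n]} | forall a, a \in msupp q -> coset_set z (- exponent a)].

Lemma exponentM (a b : 'X_{1..n}) :
  exponent (mmul a b) = exponent a + exponent b.
Proof. by apply/rowP => i; rewrite !mxE cmM. Qed.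

Lemma embedding_ring_supp (p : semigroup_ring K S) a :
  a \in msupp (embedding_ring p) -> exists s : semigroup_elt S, a = xi s.
Proof.
rewrite -mcoeff_neq0 => pa; apply: contrapT => na; move: pa.
rewrite /embedding_ring mmapE raddf_sum big1 ?eqxx // => s _ /=.
rewrite mul_malgC mcoeffZ mcoeffU1; case: eqP => [e|_]; last exact: mulr0.
by case: na; exists s.
Qed.

Lemma coset_shift (z : embedding_coset) (s : semigroup_elt S) (v : 'rV[int]_n) :
  coset_set z v -> coset_set z (v - exponent (xi s)).
Proof.
have [w ->] := coset_setP z.
move=> [_ [_ [_ [x _ <-] <-] [_ [_ [y _ <-] <-] <-]] <-].
exists (exponent (xi x) - exponent (xi (mmul y s))).
  exists (exponent (xi x)); first by exists (xi x) => //; exists x.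
  by exists (exponent (xi (mmul y s))) => //; exists (xi (mmul y s)) => //;
    exists (mmul y s).
by rewrite embeddingD exponentM opprD !addrA.
Qed.

Lemma coset_module_closed (z : embedding_coset) : coset_module_set z 0 /\
  forall (p : semigroup_ring K S) (q1 q2 : polynomial_module),
    coset_module_set z q1 -> coset_module_set z q2 ->
    coset_module_set z (p *: q1 + q2).
Proof.
split=> [a|p q1 q2 z1 z2 a]; first by rewrite msupp0 in_fset0.
rewrite restrict_scaleE => /(fsubsetP (msuppD_le _ _)); rewrite in_fsetU.
move=> /orP[/msuppM_le[_ [b [/embedding_ring_supp[s ->] /z1 zb ->]]]|/z2//].
by rewrite exponentM opprD addrC; exact: coset_shift.
Qed.

Definition coset_module (z : embedding_coset) : lmodType (semigroup_ring K S) :=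
  submodule_elt (Submodule (coset_module_closed z)).

End CosetModules.

(* Main.v *)
From HB Require Import structures.
Require Import Defs.
From mathcomp Require Import all_boot all_order all_algebra.
From mathcomp Require Import fraction finmap monalg.
From mathcomp Require Import boolp classical_sets functions reals.
From mathcomp Require Import lra zify.

(* Purity says that S consists of the x in gp(S) with all xi_i(x) >= 0, so a  *)
(* coset module is, up to a monomial factor, a monomial ideal of K[S] spanned *)
(* by some T inside S; every element of its dual is multiplication by a       *)
(* fraction, and its bidual is determined by the image of the inclusion.      *)
(* If xi_i = e_i sigma_(j_i) for all i, then T is cut out by the inequalities *)
(* sigma_j >= c_j, and each of these can be tested by a single element of the *)
(* dual, a monomial u with sigma_j(u) = -c_j; hence the ideal is reflexive.   *)
(* If some xi_i is not a multiple of any support form, then the monomials     *)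
(* congruent to minus the i-th unit vector give T = {xi_i > 0}, which meets   *)
(* every facet of S; so all forms on the ideal are multiplications by         *)
(* elements of K[S] and the bidual is K[S], while 1 is not in the ideal.      *)

Set Implicit Arguments.
Unset Strict Implicit.
Unset Printing Implicit Defensive.

Import Order.TTheory GRing.Theory Num.Theory.

Local Open Scope classical_set_scope.
Local Open Scope ring_scope.

(** Multiplication by a fractional monomial [alpha / beta] embeds a coset module in [K[S]] as the
    span of a set [P] of monomials ([coset_module_form]). Every form on it is then a fraction times
    this one embedding [theta] ([rank_one_dual]), so reflexivity becomes a question about monomials.
    It holds if each monomial outside [P] is detected by a fractional monomial that carries [P] into
    [S] ([monomial_ideal_reflexive]). It fails if all fractions carrying the ideal into [K[S]]
    already lie in [K[S]] while 1 is not in the ideal ([monomial_ideal_not_reflexive]).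

    Purity describes [S] both by [xi_i >= 0] and by [sigma_j >= 0] ([semigroup_embedding_cone],
    [semigroup_form_cone]). The hinge between the two is [form_vanishing_on_facet]: a form that is
    nonnegative on the cone and zero on a facet is a multiple of the support form of that facet.
    Hence an [xi_i] that is no such multiple is positive somewhere on every facet, which makes the
    coset of the i-th unit vector fail; if all [xi_i] are multiples, the inequalities cutting out
    [P] are tested facet by facet. *)

(** * Duals and reflexivity *)

Section Reflexive.
Variable R : comNzRingType.
Implicit Types M N : lmodType R.

Definition dual_form M (f : M -> R^o) (lf : linear f) : dual M :=
  exist _ f (mem_set lf) : submodule_elt (linear_forms M).

Lemma dual_linear M (f : dual M) : linear (sval f).
Proof. by case: f => f /= /set_mem. Qed.

Lemma form0 M (F : M -> R^o) : linear F -> F 0 = 0.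
Proof. by move=> /(_ (-1) 0 0); rewrite scaler0 addr0 scaleN1r addNr. Qed.

Lemma formZ M (F : M -> R^o) (a : R) (x : M) :
  linear F -> F (a *: x) = a * F x.
Proof. by move=> lF; rewrite -[a *: x]addr0 lF form0 // addr0. Qed.

Lemma dual_ext M (f g : dual M) : (forall x, sval f x = sval g x) -> f = g.
Proof. by move=> fg; apply: val_inj; apply/funext. Qed.

Lemma dual_scaleD M (a : R) (f g : dual M) x :
  sval (a *: f + g) x = a * sval f x + sval g x :> R.
Proof. reflexivity. Qed.

Lemma dual_scale M (a : R) (f : dual M) x : sval (a *: f) x = a * sval f x :> R.
Proof. reflexivity. Qed.

Lemma reflexiveP M : reflexive_module M <->
  (forall x y : M, (forall f : dual M, sval f x = sval f y) -> x = y) /\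
  (forall F : dual M -> R^o, linear F ->
     exists x, forall f, F f = sval f x).
Proof.
split=> [[h hK Kh]|[einj esurj]].
  split=> [x y xy|F lF].
    by apply: (can_inj hK); apply: dual_ext => f; exact: xy.
  by exists (h (dual_form lF)) => f;
    exact: (esym (congr1 (fun G => sval G f) (Kh (dual_form lF)))).
pose pre (F : dual (dual M)) := cid (esurj _ (dual_linear F)).
exists (fun F => projT1 (pre F)) => [x|F].
  by apply: einj => f; rewrite -(projT2 (pre (bidual_eval x))).
by apply: dual_ext => f; rewrite (projT2 (pre F)).
Qed.

(** Forms travel along the isomorphism: a form on the dual of [M] becomes one on the dual of [N],
    and the element representing it is carried back by [h]. *)
Lemma reflexive_isomorphic M N :
  isomorphic_modules M N -> reflexive_module N -> reflexive_module M.
Proof.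
move=> [g [h gK hK]] /reflexiveP[einj esurj].
have lh : linear h.
  by move=> a u v; apply: (can_inj gK); rewrite hK linearP !hK.
have lcomp (A B : lmodType R) (p : A -> B) (f : dual B) :
    linear p -> linear (sval f \o p : A -> R^o).
  by move=> lp a u v; rewrite /= lp (dual_linear f).
pose pull (f : dual N) : dual M := dual_form (lcomp _ _ _ f (linearP g)).
pose push (f : dual M) : dual N := dual_form (lcomp _ _ _ f lh).
have pushK f : pull (push f) = f by apply: dual_ext => x /=; rewrite gK.
apply/reflexiveP; split=> [x y xy|F lF].
  by apply: (can_inj gK); apply: einj => f; exact: (xy (pull f)).
have lFp : linear (F \o pull : dual N -> R^o).
  move=> a u v; rewrite /= -lF; congr F; apply: dual_ext => x.
  by rewrite dual_scaleD.
have [x Fx] := esurj _ lFp.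
by exists (h x) => f; rewrite -{1}(pushK f); exact: Fx.
Qed.

End Reflexive.

(** * Modules with an injective form into a domain *)

Section RankOne.
Variables (R : idomainType) (M : lmodType R) (theta : dual M).
Hypothesis theta_inj : injective (sval theta).

(* Both sides are the value of [f] at [theta x *: y = theta y *: x]. *)
Lemma rank_one_dual (f : dual M) (x y : M) :
  sval theta x * sval f y = sval f x * sval theta y :> R.
Proof.
have e : (sval theta x : R) *: y = (sval theta y : R) *: x.
  by apply: theta_inj; rewrite !(formZ _ _ (dual_linear theta)) mulrC.
by rewrite -(formZ _ _ (dual_linear f)) e (formZ _ _ (dual_linear f)) mulrC.
Qed.

Lemma rank_one_form_neq0 (x : M) : x <> 0 -> (sval theta x : R) != 0.
Proof.
by move=> x0; apply/eqP; rewrite -(form0 (dual_linear theta)) => /theta_inj.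
Qed.

(** Since [theta x1 *: f = f x1 *: theta], a form on the dual is determined by its value at [theta],
    so only that value has to be represented. *)
Lemma rank_one_reflexive :
  (exists x : M, x <> 0) ->
  (forall F : dual M -> R^o, linear F -> exists x, F theta = sval theta x) ->
  reflexive_module M.
Proof.
move=> [x1 x10] H; apply/reflexiveP; split=> [x y /(_ theta)/theta_inj//|F lF].
have [x Fx] := H F lF; exists x => f.
apply: (mulfI (rank_one_form_neq0 x10)).
have e : (sval theta x1 : R) *: f = (sval f x1 : R) *: theta.
  by apply: dual_ext => y; rewrite !dual_scale rank_one_dual.
by rewrite rank_one_dual -Fx -!(formZ _ _ lF) e.
Qed.

(** The dual is free on [theta], so taking the coefficient of [theta] is a linear form on it. The
    element that represents this form has the coefficient of [theta] itself, namely 1, as its value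
    under [theta]. *)
Lemma rank_one_principal_dual :
  (exists x : M, x <> 0) ->
  (forall f : dual M, exists g : R, forall x, sval f x = g * sval theta x) ->
  reflexive_module M -> exists x, sval theta x = 1.
Proof.
move=> [x1 x10] H /reflexiveP[_ esurj].
pose F (f : dual M) : R^o := projT1 (cid (H f)).
have FE f x : sval f x = F f * sval theta x by exact: (projT2 (cid (H f))).
have F1 f (g : R) : sval f x1 = g * sval theta x1 -> F f = g.
  by rewrite FE => /(mulIf (rank_one_form_neq0 x10)).
have lF : linear F.
  move=> a f g; apply: F1.
  by rewrite dual_scaleD mulrDl -mulrA -!FE.
have [x xP] := esurj _ lF; exists x; rewrite -xP.
by apply: F1; rewrite mul1r.
Qed.

Lemma rank_one_principal (f : dual M) (x0 : M) (b g : R) :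
  b != 0 -> sval theta x0 = b -> sval f x0 = b * g ->
  forall x, sval f x = g * sval theta x.
Proof.
move=> b0 x0b fg x; apply: (mulfI b0).
by rewrite -[in LHS]x0b rank_one_dual fg mulrA.
Qed.

(** The image of [theta], viewed in the fraction field, is an ideal of [R] itself, so 1 serves as
    common denominator. *)
Lemma rank_one_divisorial :
  (exists x : M, x <> 0) -> reflexive_module M -> divisorial_module M.
Proof.
move=> [x1 x10] rM.
pose j (x : M) : frac_module R := tofrac (sval theta x : R).
have jinj : injective j by move=> x y /eqP; rewrite tofrac_eq => /eqP/theta_inj.
have j0 : j 0 = 0 by rewrite /j (form0 (dual_linear theta)) rmorph0.
have jl : linear j.
  by move=> a x y; rewrite /j (dual_linear theta) rmorphD rmorphM.
have Iclosed : range j 0 /\ forall (a : R) (u v : frac_module R),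
    range j u -> range j v -> range j (a *: u + v).
  split; first by exists 0 => //; rewrite j0.
  by move=> a _ _ [u _ <-] [v _ <-]; exists (a *: u + v) => //; exact: jl.
pose I := Submodule Iclosed.
have jI x : j x \in submodule_set I by apply/mem_set; exists x.
pose g (x : M) : submodule_elt I := exist _ (j x) (jI x).
have gl : linear g by move=> a x y; apply: val_inj; exact: jl.
pose gL := GRing.isLinear.Build _ _ _ _ g gl.
pose G : {linear M -> submodule_elt I} := HB.pack g gL.
have [h gK hK] : bijective g.
  have pre (u : submodule_elt I) : {x | j x = val u}.
    by apply: cid; have [x _ <-] := set_mem (valP u); exists x.
  exists (fun u => projT1 (pre u)) => [x|u].
    by apply: jinj; rewrite (projT2 (pre (g x))).
  by apply: val_inj; rewrite /= (projT2 (pre u)).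
exists I; last by exists G; exists h.
split; first split.
- exists (j x1); first by exists x1.
  by rewrite -j0 => /jinj.
- exists 1; first exact: oner_neq0.
  by move=> _ [x _ <-]; exists (sval theta x); rewrite scale1r.
apply: reflexive_isomorphic rM.
have hl : linear h by move=> a u v; apply: (can_inj gK); rewrite hK gl !hK.
pose hL := GRing.isLinear.Build _ _ _ _ h hl.
by exists (HB.pack h hL : {linear submodule_elt I -> M}); exists g.
Qed.

End RankOne.
Section RankOneQuotient.
Variables (R : idomainType) (M : lmodType R) (theta : dual M).

(** The form [f] is [theta] times the fraction [a / b]. Every linear [F] preserves
    [b *: f = a *: theta], so [b] must divide [a * F theta]: this is how the dual constrains the
    bidual. *)
Lemma dual_quotient (a b : R) : b != 0 ->
  (forall x, exists p, a * sval theta x = b * p) ->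
  exists f : dual M, forall F : dual M -> R^o, linear F ->
    b * F f = a * F theta :> R.
Proof.
move=> b0 H; pose f x : R^o := projT1 (cid (H x)).
have fE x : a * sval theta x = b * f x by exact: (projT2 (cid (H x))).
have lf : linear f.
  move=> c x y; apply: (mulfI b0); rewrite -fE (dual_linear theta).
  by rewrite !mulrDr [in RHS]mulrCA -!fE mulrCA.
exists (dual_form lf) => F lF.
rewrite -!(formZ _ _ lF); congr F; apply: dual_ext => x.
by rewrite [RHS]fE.
Qed.

End RankOneQuotient.

(** * Multiplication by a monomial *)

Lemma malgUU (K : fieldType) (M : monomType) (a b : K) (k l : M) :
  << a *g k >> * << b *g l >> = << a * b *g mmul k l >> :> {malg K[M]}.
Proof. by rewrite malgM_def fgmulUU. Qed.

Section MonomialMultiplication.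
Variables (K : fieldType) (M : conomType) (k : M).
Hypothesis mul_inj : injective (mmul k).
Implicit Types p q : {malg K[M]}.

Lemma msupp_mulU q l : l \in msupp (<< k >> * q) ->
  exists2 l', l' \in msupp q & l = mmul k l'.
Proof.
case/msuppM_le => k1 [k2]; rewrite msuppU1 in_fset1 => -[/eqP-> k2q ->].
by exists k2.
Qed.

Lemma mcoeff_mulU q l : (<< k >> * q)@_(mmul k l) = q@_l.
Proof.
rewrite malgM_def fgmulUg raddf_sum /= [in RHS](monalgE q) raddf_sum /=.
by apply: eq_bigr => i _; rewrite !mcoeffU (inj_eq mul_inj) mul1r.
Qed.

Lemma mem_msupp_mulU q l : (mmul k l \in msupp (<< k >> * q)) = (l \in msupp q).
Proof. by rewrite -!mcoeff_neq0 mcoeff_mulU. Qed.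

Lemma mulU_inj : injective ( *%R (<< k >> : {malg K[M]})).
Proof.
by move=> p q pq; apply/malgP => l; rewrite -(mcoeff_mulU p) pq mcoeff_mulU.
Qed.

Lemma mulU_divides p :
  (forall l, l \in msupp p -> exists l', l = mmul k l') ->
  exists q, p = << k >> * q.
Proof.
move=> H; pose d l := xget mone [set l' | l = mmul k l'].
exists (\sum_(l <- msupp p) << p@_l *g d l >>).
rewrite mulr_sumr [LHS]monalgE; apply: eq_big_seq => l /H[l' ll'].
rewrite malgM_def fgmulUU mul1r -/(d l).
by have <- : l = mmul k (d l) by
  exact: (@xgetPex _ mone [set l' | l = mmul k l'] (ex_intro _ l' ll')).
Qed.

End MonomialMultiplication.

Lemma mmul_exponent_inj n (a : 'X_{1..n}) : injective (mmul a).
Proof.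
move=> b c abc; apply/eqP/cmP => i; apply: (@addnI (a i)).
by rewrite -!cmM abc.
Qed.

Lemma mmul_semigroup_inj m (S : posAffineSemigroup m) (t : semigroup_elt S) :
  injective (mmul t).
Proof. by move=> x y /(congr1 val) /addrI /val_inj. Qed.

Lemma linear_relation (A : comPzRingType) (x y a u v fu fv : A) :
  x * u = y * fu -> x * v = y * fv -> x * (a * u + v) = y * (a * fu + fv).
Proof. by move=> eu ev; rewrite !mulrDr mulrCA eu ev mulrCA. Qed.

(** * Coset modules as monomial ideals *)

Section CosetModuleForm.
Variables (K : fieldType) (m n : nat) (S : posAffineSemigroup m).
Variable xi : pureEmbedding n S.
Local Notation eps := (@embedding_ring K m n S xi).

Lemma embedding_ringU (c : K) t : eps << c *g t >> = << c *g xi t >>.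
Proof.
by rewrite /embedding_ring mmapU malgM_def fgmulUU mulr1 mul1m.
Qed.

Lemma mcoeff_embedding_ring p t : (eps p)@_(xi t) = (p : {malg K[_]})@_t.
Proof.
rewrite [in RHS](monalgE (p : {malg K[_]})) [in LHS](monalgE (p : {malg K[_]})).
rewrite [eps _](raddf_sum eps) !raddf_sum /=; apply: eq_bigr => u _.
by rewrite embedding_ringU !mcoeffU (inj_eq (@embedding_inj _ _ _ xi)).
Qed.

Lemma embedding_ring_inj : injective eps.
Proof.
by move=> p q pq; apply/malgP => t; rewrite -!mcoeff_embedding_ring pq.
Qed.

Lemma shift_into_ring (alpha beta : 'X_{1..n}) (q : {mpoly K[n]}) :
  (forall b, b \in msupp q -> exists t, mmul alpha b = mmul beta (xi t)) ->
  exists p : semigroup_ring K S, << alpha >> * q = << beta >> * eps p.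
Proof.
move=> H; pose d b := xget mone [set t | mmul alpha b = mmul beta (xi t)].
exists (\sum_(b <- msupp q) << q@_b *g d b >> : {malg K[_]}).
have -> : eps (\sum_(b <- msupp q) << q@_b *g d b >>) =
    \sum_(b <- msupp q) << q@_b *g xi (d b) >>.
  rewrite [LHS](raddf_sum eps); apply: eq_bigr => b _; exact: embedding_ringU.
rewrite [in LHS](monalgE q).
rewrite [LHS]mulr_sumr.
rewrite [RHS]mulr_sumr.
apply: eq_big_seq => b /H[t bt].
rewrite [LHS]malgUU [RHS]malgUU mul1r.
by have <- : mmul alpha b = mmul beta (xi (d b)) by
  exact: (@xgetPex _ mone [set t | mmul alpha b = mmul beta (xi t)]
    (ex_intro _ t bt)).
Qed.

Variables (z : embedding_coset xi) (alpha beta : 'X_{1..n}).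
Hypothesis shift : forall b, coset_set z (- exponent b) ->
  exists t, mmul alpha b = mmul beta (xi t).

(** The monomial basis of the image of the coset module in [K[S]]. *)
Definition shifted_coset : set (semigroup_elt S) :=
  [set t | exists2 b, coset_set z (- exponent b) &
                      mmul alpha b = mmul beta (xi t)].

(* [theta] is multiplication by the fractional monomial [alpha / beta]. *)
Lemma coset_module_form : exists theta : dual (coset_module K z),
  [/\ injective (sval theta),
      forall q t, t \in msupp (sval theta q : {malg K[_]}) -> shifted_coset t
    & forall p : semigroup_ring K S,
        (forall t, t \in msupp (p : {malg K[_]}) -> shifted_coset t) ->
        exists q, sval theta q = p].
Proof.
pose rel (q : coset_module K z) (p : semigroup_ring K S) :=
  << alpha >> * (val q : {mpoly K[n]}) = << beta >> * eps p.
have ainj := mulU_inj (K := K) (@mmul_exponent_inj n alpha).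
have binj := mulU_inj (K := K) (@mmul_exponent_inj n beta).
have relU q p1 p2 : rel q p1 -> rel q p2 -> p1 = p2.
  rewrite /rel => r1 r2; have r12 := etrans (esym r1) r2.
  exact: embedding_ring_inj (binj _ _ r12).
have zq (q : coset_module K z) b :
    b \in msupp (val q : {mpoly K[n]}) -> coset_set z (- exponent b).
  by move=> bq; exact: (set_mem (valP q)).
have relE q : exists p, rel q p.
  by apply: shift_into_ring => b /zq/shift.
pose f q : (semigroup_ring K S)^o := projT1 (cid (relE q)).
have fE q : rel q (f q) by exact: (projT2 (cid (relE q))).
have lf : linear f.
  move=> a u v; apply: relU (fE _) _; rewrite /rel.
  have -> : eps (a *: f u + f v) = eps a * eps (f u) + eps (f v).
    have -> : eps a * eps (f u) = eps (a *: f u) := esym (rmorphM eps a (f u)).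
    exact: (rmorphD eps (a *: f u) (f v)).
  exact: (linear_relation (eps a) (fE u) (fE v)).
exists (dual_form lf); split=> /= [q1 q2 q12|q t tf|p Tp].
- by apply: val_inj; apply: ainj; rewrite [LHS]fE [RHS]fE q12.
- have : mmul beta (xi t) \in msupp (<< beta >> * eps (f q)).
    rewrite (mem_msupp_mulU (@mmul_exponent_inj n beta)).
    by rewrite -mcoeff_neq0 mcoeff_embedding_ring mcoeff_neq0.
  rewrite -fE => /msupp_mulU[b /zq bz ab].
  by exists b.
(* Each monomial of [<< beta >> * eps p] is [alpha] times a monomial of the coset, so the quotient
   by [alpha] is the required preimage. *)
- have Tl l : l \in msupp (<< beta >> * eps p) ->
      exists2 b, coset_set z (- exponent b) & l = mmul alpha b.
    case/msupp_mulU => b bp ->; have [t bt] := embedding_ring_supp bp.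
    case: (Tp t) => [|b' zb' ab']; last by exists b'; rewrite // bt ab'.
    by rewrite -mcoeff_neq0 -(mcoeff_embedding_ring p) -bt mcoeff_neq0.
  have [l /Tl[b _ ->]|q pq] := @mulU_divides K _ alpha (<< beta >> * eps p).
    by exists b.
  have qz : (q : polynomial_module K xi) \in coset_module_set z.
    apply/mem_set => b bq; have /Tl[b' zb' /mmul_exponent_inj->//] :
      mmul alpha b \in msupp (<< beta >> * eps p).
    by rewrite pq (mem_msupp_mulU (@mmul_exponent_inj n alpha)).
  pose Q : coset_module K z := exist _ (q : polynomial_module K xi) qz.
  have Qp : rel Q p := esym pq.
  by exists Q; have := relU _ _ _ (fE Q) Qp.
Qed.

End CosetModuleForm.

(** * Integral linear forms *)

Section LinearForms.
Variables (A : pzRingType) (r : nat).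
Implicit Types (c : 'rV[int]_r) (x : 'rV[A]_r).

Lemma lform_is_zmod_morphism c : zmod_morphism (@lform A r c).
Proof.
move=> x y; rewrite /lform -sumrB; apply: eq_bigr => k _.
by rewrite !mxE mulrzBl.
Qed.

HB.instance Definition _ c :=
  GRing.isZmodMorphism.Build 'rV[A]_r A (@lform A r c)
    (lform_is_zmod_morphism c).

Lemma lformZ c (a : A) x : lform c (a *: x) = a * lform c x.
Proof.
rewrite /lform mulr_sumr; apply: eq_bigr => k _.
by rewrite mxE mulrzAr.
Qed.

Lemma lform_map_intr c (u : 'rV[int]_r) :
  lform c (map_mx intr u : 'rV[A]_r) = (lform c u)%:~R.
Proof.
rewrite /lform rmorph_sum; apply: eq_bigr => k _.
by rewrite mxE /= mulrzz intrM mulrzr.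
Qed.

End LinearForms.

Lemma lform_delta r (c : 'rV[int]_r) k :
  lform c (delta_mx 0 k : 'rV[int]_r) = c 0 k.
Proof.
rewrite /lform (bigD1 k) //= big1 => [|l lk]; rewrite !mxE eqxx /=.
  by rewrite eqxx addr0 intz.
by rewrite (negPf lk) mul0rz.
Qed.

Lemma lform_complete r (F : 'rV[int]_r -> int) : zmod_morphism F ->
  exists c, F =1 lform c.
Proof.
move=> FB; pose Fm := GRing.isZmodMorphism.Build _ _ F FB.
pose F' : {additive 'rV[int]_r -> int} := HB.pack F Fm.
exists (\row_k F (delta_mx 0 k)) => u; rewrite [in LHS](row_sum_delta u).
rewrite [LHS](raddf_sum F'); apply: eq_bigr => k _; rewrite mxE.
rewrite -[u 0 k in LHS]intz scaler_int [LHS](raddfMz F').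
by rewrite mulrzz mulrC -mulrzz.
Qed.

Lemma lform_gcd r (c : 'rV[int]_r) :
  exists w : 'rV[int]_r, lform c w = (\big[gcdn/0%N]_(k < r) `|c ord0 k|%N)%:Z.
Proof.
elim: (index_enum _) => [|k l [w IH]].
  by exists 0; rewrite big_nil raddf0.
rewrite big_cons; have [a [b e]] := Bezoutz (c ord0 k) (lform c w).
exists (a *: delta_mx 0 k + b *: w); rewrite raddfD /= !lformZ lform_delta e.
by rewrite IH /gcdz absz_nat.
Qed.

(** * Lattice points and facets of the cone *)

Section Facets.
Variables (RR : realType) (r s : nat) (sigma : 'I_s -> 'rV[int]_r).

Definition form_cone : set 'rV[int]_r :=
  [set u | forall j, 0 <= lform (sigma j) u].

Hypothesis sigma_coprime :
  forall j, \big[gcdn/0%N]_(k < r) `|sigma j ord0 k|%N = 1%N.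
Hypothesis cone_full : forall u, gp form_cone u.
Hypothesis irredundant : forall j0,
  [set x : 'rV[RR]_r | forall j, 0 <= lform (sigma j) x] <>
  [set x | forall j, j != j0 -> 0 <= lform (sigma j) x].

Lemma support_form_onto j a : exists w : 'rV[int]_r, lform (sigma j) w = a.
Proof.
have [w e] := lform_gcd (sigma j); exists (a *: w).
by rewrite lformZ e sigma_coprime mulr1.
Qed.

(** A vector with [sigma j] equal to 1 is a difference of cone points, so [sigma j] is positive at
    the first of them; these points are summed over [j]. *)
Lemma cone_interior : exists p : 'rV[int]_r, forall j, 0 < lform (sigma j) p.
Proof.
have pos j : exists2 p, form_cone p & 0 < lform (sigma j) p.
  have [w w1] := support_form_onto j 1; have [p Pp [q Qq pq]] := cone_full w.
  exists p => //; have -> : p = w + q by rewrite -pq subrK.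
  by rewrite raddfD /= w1 ltr_wpDr.
pose p j := s2val (cid2 (pos j)).
have pP j : form_cone (p j) by exact: (s2valP (cid2 (pos j))).
exists (\sum_j p j) => j; rewrite raddf_sum (bigD1 j) //=.
by rewrite ltr_wpDr ?(s2valP' (cid2 (pos j))) // sumr_ge0 // => k _; exact: pP.
Qed.

Lemma lform_floor (c : 'rV[int]_r) (x : 'rV[RR]_r) :
  `| (lform c (map_mx Num.floor x))%:~R - lform c x| <=
    (\sum_k `|c 0 k|)%:~R.
Proof.
rewrite -lform_map_intr -raddfB /= rmorph_sum /=.
apply: le_trans (ler_norm_sum _ _ _) _; apply: ler_sum => k _.
rewrite -mulrzr normrM -intr_norm ler_piMl ?ler0z //.
rewrite !mxE distrC ger0_norm ?subr_ge0 ?floor_le_tmp //.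
by have := floorD1_gt (x 0 k); rewrite rmorphD /=; lra.
Qed.

(** Irredundancy gives a real point that violates only the inequality [j0]. It is scaled up, rounded
    to the lattice, and moved inwards to absorb the rounding error. *)
Lemma beyond_facet j0 : exists y : 'rV[int]_r, lform (sigma j0) y < 0 /\
  forall j, j != j0 -> 0 < lform (sigma j) y.
Proof.
have estimate1 (a b c d e : RR) :
    a <= d + e -> e <= b -> b + c < - d -> a + c < 0.
  by lra.
have estimate2 (a b d e : RR) : d - e <= a -> e <= b -> 0 <= d -> - b <= a.
  by lra.
have estimate3 (a b c : int) :
    0 <= b -> - b <= a -> 0 < c -> 0 < a + (b + 1) * c.
  by nia.
have [x xP] : exists x : 'rV[RR]_r, lform (sigma j0) x < 0 /\
    forall j, j != j0 -> 0 <= lform (sigma j) x.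
  apply: contrapT => H; apply: (irredundant (j0 := j0)).
  apply/seteqP; split=> [x xP j _|x xP j]; first exact: xP.
  have [->|/xP//] := eqVneq j j0.
  by rewrite leNgt; apply/negP => x0; apply: H; exists x.
have [p p0] := cone_interior; move: xP => [x0 x1].
(* [B] bounds the rounding error of all forms at once, so adding [(B + 1) *: p] outweighs it. *)
pose B : int := \sum_j \sum_k `|sigma j 0 k|.
have Bj j : \sum_k `|sigma j 0 k| <= B.
  by rewrite /B (bigD1 j) //= lerDl sumr_ge0 // => i _; apply: sumr_ge0.
have B0 : 0 <= B by rewrite sumr_ge0 // => i _; apply: sumr_ge0.
(* [C] is the most that rounding and the inward shift can add to [sigma j0]; scaling by [N] must
   beat it. *)
pose C : RR := (B + (B + 1) * lform (sigma j0) p)%:~R.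
have [N NC] : exists N : nat, C < N%:R * - lform (sigma j0) x.
  exists (Num.truncn (C / - lform (sigma j0) x)).+1.
  by rewrite -ltr_pdivrMr ?oppr_gt0 // truncnS_gt.
pose y := map_mx Num.floor (N%:R *: x) + (B + 1) *: p.
have near j := lform_floor (sigma j) (N%:R *: x).
have hB j : ((\sum_k `|sigma j 0 k|)%:~R : RR) <= B%:~R by rewrite ler_int.
exists y; split=> [|j jj0]; rewrite /y raddfD /= lformZ.
  rewrite -(ltrz0 RR) rmorphD /=.
  have := near j0; rewrite lformZ ler_distl => /andP[_ h].
  move: NC (hB j0); rewrite /C rmorphD /= mulrN => NC hBj.
  exact: estimate1 h hBj NC.
apply: estimate3 B0 _ (p0 j).
rewrite -(ler_int RR) rmorphN /=.
have := near j; rewrite lformZ ler_distl => /andP[h _].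
by apply: estimate2 h (hB j) _; rewrite mulr_ge0 ?x1.
Qed.

(** The segment from an interior point to a point beyond the facet crosses the facet; clearing
    denominators makes the crossing integral. *)
Lemma facet_interior j0 : exists v : 'rV[int]_r, lform (sigma j0) v = 0 /\
  forall j, j != j0 -> 0 < lform (sigma j) v.
Proof.
have [p p0] := cone_interior; have [y [y0 y1]] := beyond_facet j0.
exists (lform (sigma j0) p *: y - lform (sigma j0) y *: p); split=> [|j jj0].
  by rewrite raddfB /= !lformZ mulrC subrr.
rewrite raddfB /= !lformZ subr_gt0 (@lt_trans _ _ 0) ?mulr_gt0 ?y1 //.
by rewrite nmulr_rlt0.
Qed.

(** By integrality each [sigma j] is at least 1 at [v], so any [N] above all [|sigma j (w)|]
    works. *)
Lemma facet_translate j0 (w v : 'rV[int]_r) :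
  (forall j, j != j0 -> 0 < lform (sigma j) v) ->
  exists N : nat, forall j, j != j0 -> 0 <= lform (sigma j) (w + v *+ N).
Proof.
move=> v0; exists (\sum_j `|lform (sigma j) w|%N)%N => j jj0.
have wj : (`|lform (sigma j) w| <= \sum_j `|lform (sigma j) w|)%N.
  by rewrite (bigD1 j) //= leq_addr.
rewrite raddfD /= raddfMn /=; have := v0 j jj0.
move: (lform _ v) (lform _ w) (\sum_j _)%N wj => a b N.
by rewrite -mulr_natr natz; nia.
Qed.

(* The facet [sigma j0 = 0] spans a hyperplane: adding a large multiple of an *)
(* interior point of the facet moves any [w] of the hyperplane into the cone. *)
Lemma form_vanishing_on_facet j0 (c : 'rV[int]_r) :
  (forall u, form_cone u -> 0 <= lform c u) ->
  (forall u, form_cone u -> lform (sigma j0) u = 0 -> lform c u = 0) ->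
  exists e : nat, forall u : 'rV[int]_r, lform c u = e%:Z * lform (sigma j0) u.
Proof.
move=> c0 cF; have [v [v0 v1]] := facet_interior j0.
have coneN (w : 'rV[int]_r) : 0 <= lform (sigma j0) w ->
    exists2 N : nat, form_cone (w + v *+ N) &
      lform (sigma j0) (w + v *+ N) = lform (sigma j0) w.
  have [N wN] := facet_translate w v1 => w0.
  have e : lform (sigma j0) (w + v *+ N) = lform (sigma j0) w.
    by rewrite raddfD /= raddfMn /= v0 mul0rn addr0.
  by exists N => // j; have [->|/wN//] := eqVneq j j0; rewrite e.
have cv : lform c v = 0.
  by apply: (cF _ _ v0) => j; have [->|/v1/ltW//] := eqVneq j j0; rewrite v0.
have cvN w N : lform c (w + v *+ N) = lform c w.
  by rewrite raddfD /= raddfMn /= cv mul0rn addr0.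
have c_ker (w : 'rV[int]_r) : lform (sigma j0) w = 0 -> lform c w = 0.
  move=> w0; have [|N wN e] := coneN w; first by rewrite w0.
  by rewrite -(cvN w N); apply: cF; rewrite ?e.
have [w0 w01] := support_form_onto j0 1.
have c_w0 : 0 <= lform c w0.
  have [|N wN _] := coneN w0; first by rewrite w01.
  by rewrite -(cvN w0 N); exact: c0.
(* Subtracting [sigma j0 (u)] times [w0] from [u] lands in the hyperplane, where [c] vanishes; so
   the factor is [c] at [w0]. *)
exists `|lform c w0|%N => u; rewrite gez0_abs // mulrC -lformZ.
apply/eqP; rewrite -subr_eq0 -raddfB /=; apply/eqP/c_ker.
by rewrite raddfB /= lformZ w01 mulr1 subrr.
Qed.

End Facets.

(** * Reflexivity of monomial ideals *)

Section MonomialIdeals.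
Variables (K : fieldType) (m : nat) (S : posAffineSemigroup m).
Local Notation R := (semigroup_ring K S).
Local Notation T := (semigroup_elt S).
Local Notation supp p := (msupp (p : {malg K[semigroup_elt S]})).
Variables (M : lmodType R) (theta : dual M) (P : set T).
Hypothesis theta_inj : injective (sval theta).
Hypothesis theta_supp : forall x t, t \in supp (sval theta x) -> P t.
Hypothesis theta_onto : forall p : R,
  (forall t, t \in supp p -> P t) -> exists x, sval theta x = p.

Definition monomial_elt (t : T) : R := << t >> : {malg K[semigroup_elt S]}.

Lemma monomial_elt_neq0 t : monomial_elt t != 0.
Proof. by rewrite [_ == _]monalgU_eq0 oner_neq0. Qed.

Lemma theta_monomial t : P t -> exists x, sval theta x = monomial_elt t.
Proof.
by move=> Pt; apply: theta_onto => u; rewrite msuppU1 in_fset1 => /eqP->.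
Qed.

Lemma monomial_neq0 t : P t -> exists x : M, x <> 0.
Proof.
move=> /theta_monomial[x xt]; exists x => x0.
by have := monomial_elt_neq0 t; rewrite -xt x0 (form0 (dual_linear theta)) eqxx.
Qed.

Lemma monomial_mul_supp a u (p q : R) : u \in supp p ->
  monomial_elt a * p = q -> mmul a u \in supp q.
Proof.
by move=> up <-; rewrite [_ \in _](mem_msupp_mulU (@mmul_semigroup_inj m S a)).
Qed.

Lemma monomial_mul_suppP a u (p : R) : u \in supp (monomial_elt a * p) ->
  exists2 t, t \in supp p & u = mmul a t.
Proof. exact: msupp_mulU. Qed.

Lemma monomial_divides a (p : R) :
  (forall t, t \in supp p -> exists t', t = mmul a t') ->
  exists q, p = monomial_elt a * q.
Proof. exact: mulU_divides. Qed.

(** By [dual_quotient], each fraction [g / h] carrying [P] into [S] also carries the support of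
    [F theta] into [S]. Separation then leaves only monomials of [P] there, so [F theta] is a value
    of [theta]. *)
Lemma monomial_ideal_reflexive t0 : P t0 ->
  (forall x, ~ P x -> exists g h,
     (forall t, P t -> exists t', mmul g t = mmul h t') /\
     ~ exists t', mmul g x = mmul h t') ->
  reflexive_module M.
Proof.
move=> Pt0 sep; apply: (rank_one_reflexive theta_inj (monomial_neq0 Pt0)).
move=> F lF; have [|x Fx] := @theta_onto (F theta); last by exists x.
move=> t tF; apply: contrapT => /sep[g [h [gP]]]; apply.
have [x|f fF] :=
  @dual_quotient R M theta (monomial_elt g) _ (monomial_elt_neq0 h).
  apply: monomial_divides => u /monomial_mul_suppP[t1 /theta_supp/gP[t2 e] ->].
  by exists t2.
have /monomial_mul_suppP[t' _ ->] := monomial_mul_supp tF (esym (fF F lF)).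
by exists t'.
Qed.

(** The third hypothesis says that a fractional monomial [x / a] carrying [P] into [S] lies in [S].
    Hence every form is an [R]-multiple of [theta], and reflexivity would make 1 a value of
    [theta]. *)
Lemma monomial_ideal_not_reflexive t0 : P t0 -> ~ P mone ->
  (forall a x, P a -> (forall u, P u -> exists t, mmul u x = mmul a t) ->
     exists t, x = mmul a t) ->
  ~ reflexive_module M.
Proof.
move=> Pt0 P1 div rM; have [x0 x0E] := theta_monomial Pt0.
have [f|x x1] := rank_one_principal_dual theta_inj (monomial_neq0 Pt0) _ rM.
  have [t tf|g fg] := @monomial_divides t0 (sval f x0).
    apply: (div t0 t Pt0) => u /theta_monomial[y yE].
    have := rank_one_dual theta_inj f y x0; rewrite x0E yE => e.
    have e' := etrans e (mulrC (sval f y : R) (monomial_elt t0)).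
    have /monomial_mul_suppP[t' _ ut] := monomial_mul_supp tf e'.
    by exists t'.
  exists g.
  exact: (@rank_one_principal R M theta theta_inj f x0 (monomial_elt t0) g
    (monomial_elt_neq0 t0) x0E fg).
apply/P1/(@theta_supp x); rewrite x1 -mcoeff_neq0.
by rewrite [X in X != _](@mcoeff1 (semigroup_elt S) K mone) eqxx oner_neq0.
Qed.

End MonomialIdeals.

(** * The semigroup in lattice coordinates *)

Lemma exponent_onto n (f : 'I_n -> nat) : exists a : 'X_{1..n}, a =1 f.
Proof.
exists [cmonom f i | i in seq_fset tt (enum 'I_n)]%M => i.
by rewrite cmE fsfun_fun seq_fsetE mem_enum.
Qed.

Section Coordinates.
Variables (RR : realType) (m r n s : nat) (S : posAffineSemigroup m).
Variables (xi : pureEmbedding n S).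
Variable phi : {additive 'rV[int]_r -> 'rV[int]_m}.
Variable sigma : 'I_s -> 'rV[int]_r.
Hypothesis phi_inj : injective phi.
Hypothesis phi_range : range phi = gp S.
Hypothesis sigma_support : support_forms RR S phi sigma.
Implicit Types (x y t : semigroup_elt S) (u v w : 'rV[int]_r).

Lemma phi_diff x y : exists u, phi u = val x - val y.
Proof.
have : gp S (val x - val y).
  by exists (val x); [exact: set_mem (valP x)|exists (val y) => //;
    exact: set_mem (valP y)].
by rewrite -phi_range => -[u _ <-]; exists u.
Qed.

Lemma diff_phi u : exists x y, phi u = val x - val y.
Proof.
have : gp S (phi u) by rewrite -phi_range; exists u.
move=> [x Sx [y Sy <-]].
by exists (exist _ x (mem_set Sx)), (exist _ y (mem_set Sy)).
Qed.

Lemma coord_ex x : exists u, phi u = val x.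
Proof.
by have [u] := phi_diff x (semigroup_zero S); rewrite subr0; exists u.
Qed.

Definition lattice_coord x : 'rV[int]_r := projT1 (cid (coord_ex x)).

Lemma coordK x : phi (lattice_coord x) = val x.
Proof. exact: (projT2 (cid (coord_ex x))). Qed.

Lemma coord_diff x y u :
  phi u = val x - val y <-> u = lattice_coord x - lattice_coord y.
Proof.
split=> [e|->]; last by rewrite raddfB /= !coordK.
by apply: phi_inj; rewrite raddfB /= !coordK.
Qed.

Lemma coordM x y : lattice_coord (mmul x y) = lattice_coord x + lattice_coord y.
Proof. by apply: phi_inj; rewrite raddfD /= !coordK. Qed.

Lemma coord_inj : injective lattice_coord.
Proof. by move=> x y e; apply: val_inj; rewrite -!coordK e. Qed.

Lemma coord_gp u : exists x y, u = lattice_coord x - lattice_coord y.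
Proof.
by have [x [y e]] := diff_phi u; exists x, y; apply/coord_diff.
Qed.

(** This makes the extension of [xi_i] to differences well defined. *)
Lemma coord_embed i x y x' y' :
  lattice_coord x - lattice_coord y = lattice_coord x' - lattice_coord y' ->
  (xi x i)%:Z - (xi y i)%:Z = (xi x' i)%:Z - (xi y' i)%:Z.
Proof.
move=> e; have : mmul x y' = mmul x' y.
  apply: coord_inj; rewrite !coordM; move/eqP: e.
  by rewrite subr_eq addrAC eq_sym subr_eq eq_sym => /eqP.
move=> /(congr1 (fun t => xi t i)); rewrite !embeddingD !cmM; lia.
Qed.

Lemma embedding_forms : exists c : 'I_n -> 'rV[int]_r,
  forall i x, (xi x i)%:Z = lform (c i) (lattice_coord x).
Proof.
pose F i u : int := let x := projT1 (cid (coord_gp u)) in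
  let y := projT1 (cid (projT2 (cid (coord_gp u)))) in
  (xi x i)%:Z - (xi y i)%:Z.
have FE i x y :
    F i (lattice_coord x - lattice_coord y) = (xi x i)%:Z - (xi y i)%:Z.
  rewrite /F; case: cid => /= x' ex; case: cid => /= y' /esym.
  exact: coord_embed.
have /(_ _)/lform_complete/cid FB i : zmod_morphism (F i).
  move=> u v; have [x [y ->]] := coord_gp u; have [x' [y' ->]] := coord_gp v.
  have -> : lattice_coord x - lattice_coord y -
        (lattice_coord x' - lattice_coord y') =
      lattice_coord (mmul x y') - lattice_coord (mmul x' y).
    by rewrite !coordM opprB opprD addrACA [- lattice_coord y + _]addrC.
  by rewrite !FE !embeddingD !cmM; lia.
exists (fun i => projT1 (FB i)) => i x; rewrite -(projT2 (FB i)).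
have -> : lattice_coord x = lattice_coord x - lattice_coord (semigroup_zero S).
  by apply/coord_diff; rewrite coordK subr0.
have xi0 : xi (semigroup_zero S) = mone := embedding0 xi.
by rewrite FE xi0 cm1 subr0.
Qed.

Variable c : 'I_n -> 'rV[int]_r.
Hypothesis cE : forall i x, (xi x i)%:Z = lform (c i) (lattice_coord x).

Lemma exponent_diff_pure a x y :
  exponent a = exponent (xi x) - exponent (xi y) -> exists t, a = xi t.
Proof.
move=> e; have : range xi a.
  rewrite embedding_pure /= e; exists (exponent (xi x)).
    by exists (xi x) => //; exists x.
  by exists (exponent (xi y)) => //; exists (xi y) => //; exists y.
by case=> t _ <-; exists t.
Qed.

(** A difference with nonnegative [xi]-coordinates is an exponent vector in the group of [xi(S)], so
    purity puts it in [xi(S)]. *)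
Lemma semigroup_embedding_cone u :
  (exists x, lattice_coord x = u) <-> forall i, 0 <= lform (c i) u.
Proof.
split=> [[x <-] i|u0]; first by rewrite -cE.
have [x [y uE]] := coord_gp u.
have [a aE] := exponent_onto (fun i => `|lform (c i) u|%N).
have [|t tE] := @exponent_diff_pure a x y.
  by apply/rowP => i; rewrite !mxE aE gez0_abs // !cE uE raddfB.
exists t; rewrite uE; apply/eqP; rewrite -subr_eq0 opprB addrA subr_eq0 -coordM.
apply/eqP; congr lattice_coord; apply: (@embedding_inj _ _ _ xi).
rewrite embeddingD -tE.
apply/eqP/cmP => i; rewrite cmM aE.
have := u0 i; rewrite uE raddfB /= -!cE.
by move: (xi x i) (xi y i) => p q; lia.
Qed.

(** A lattice point of the real cone is a nonnegative combination of points of [S], so every [c i]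
    is nonnegative at it and purity applies. *)
Lemma semigroup_form_cone u :
  (exists x, lattice_coord x = u) <-> form_cone sigma u.
Proof.
have [_ coneE _] := sigma_support; split=> [[x xu] j|u0].
  have : semigroup_cone RR S phi (map_mx intr u).
    exists 1%N, (fun=> 1), (fun=> map_mx intr u); split=> //.
      move=> _; exists u => //; rewrite /= -xu coordK; exact: set_mem (valP x).
    by rewrite big_ord1 scale1r.
  by rewrite coneE => /(_ j); rewrite lform_map_intr ler0z.
apply/semigroup_embedding_cone => i.
have : semigroup_cone RR S phi (map_mx intr u).
  by rewrite coneE => j; rewrite lform_map_intr ler0z; exact: u0.
move=> [l [a [v [a0 vS e]]]]; rewrite -(ler0z RR) -lform_map_intr e raddf_sum.
apply: sumr_ge0 => k _; rewrite /= lformZ mulr_ge0 //.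
have [w Sw <-] := vS k; rewrite lform_map_intr ler0z.
have -> : w = lattice_coord (exist _ (phi w) (mem_set Sw)).
  by apply: phi_inj; rewrite coordK.
by rewrite -cE.
Qed.

Lemma form_cone_full u : gp (form_cone sigma) u.
Proof.
have [x [y ->]] := coord_gp u; exists (lattice_coord x);
  last exists (lattice_coord y) => //.
  by apply/semigroup_form_cone; exists x.
by apply/semigroup_form_cone; exists y.
Qed.

Lemma support_irredundant j0 :
  [set x : 'rV[RR]_r | forall j, 0 <= lform (sigma j) x] <>
  [set x | forall j, j != j0 -> 0 <= lform (sigma j) x].
Proof. by have [_ <- irr] := sigma_support; exact: irr. Qed.

Lemma mmul_divides a x : form_cone sigma (lattice_coord x - lattice_coord a) ->
  exists t, x = mmul a t.
Proof.
move/semigroup_form_cone => [t te]; exists t; apply: coord_inj.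
by rewrite coordM te addrC subrK.
Qed.

Lemma form_coord_ge0 j x : 0 <= lform (sigma j) (lattice_coord x).
Proof.
have [+ _] := semigroup_form_cone (lattice_coord x).
by apply; exists x.
Qed.

(** Without support forms [S] would be closed under negation, hence zero by positivity. *)
Lemma support_form_exists : semigroup_set S <> [set 0] -> exists j : 'I_s, True.
Proof.
move=> Sn0; apply: contrapT => noj; apply: Sn0; apply/seteqP; split=> x /=.
  move=> Sx; pose x' : semigroup_elt S := exist _ x (mem_set Sx).
  have /semigroup_form_cone[y yE] : form_cone sigma (- lattice_coord x').
    by move=> j; case: noj; exists j.
  apply: (@semigroup_pos _ S) => //.
  have <- : val y = - x by rewrite -coordK yE raddfN /= coordK.
  exact: set_mem (valP y).
by move=> ->; exact: set_mem (semigroup0 S).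
Qed.

End Coordinates.

(** * Differences inside a coset *)

Section Cosets.
Variables (m n : nat) (S : posAffineSemigroup m) (xi : pureEmbedding n S).

Lemma embedding_gpP g : embedding_gp xi g <->
  exists x y, g = exponent (xi x) - exponent (xi y).
Proof.
split=> [[_ [_ [x _ <-] <-] [_ [_ [y _ <-] <-] <-]]|[x [y ->]]].
  by exists x, y.
exists (exponent (xi x)); first by exists (xi x) => //; exists x.
by exists (exponent (xi y)) => //; exists (xi y) => //; exists y.
Qed.

Variable z : embedding_coset xi.

Lemma coset_sub v w : coset_set z v -> coset_set z w ->
  exists x y, w - v = exponent (xi x) - exponent (xi y).
Proof.
have [a ->] := coset_setP z.
move=> [_ /embedding_gpP[x [y ->]] <-] [_ /embedding_gpP[x' [y' ->]] <-].
exists (mmul x' y), (mmul y' x); rewrite !embeddingD !exponentM.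
by rewrite [a + _]addrC addrKA opprB opprD addrACA.
Qed.

Lemma coset_add v x y : coset_set z v ->
  coset_set z (v + (exponent (xi x) - exponent (xi y))).
Proof.
have [a ->] := coset_setP z; move=> [_ /embedding_gpP[x' [y' ->]] <-].
rewrite -addrA; eexists; last by [].
apply/embedding_gpP; exists (mmul x' x), (mmul y' y).
by rewrite !embeddingD !exponentM opprD addrACA.
Qed.

End Cosets.

(** * The two implications *)

Section Directions.
Variables (RR : realType) (K : fieldType) (m r n s : nat).
Variables (S : posAffineSemigroup m) (xi : pureEmbedding n S).
Variable phi : {additive 'rV[int]_r -> 'rV[int]_m}.
Variable sigma : 'I_s -> 'rV[int]_r.
Hypothesis phi_inj : injective phi.
Hypothesis phi_range : range phi = gp S.
Hypothesis sigma_support : support_forms RR S phi sigma.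
Variable c : 'I_n -> 'rV[int]_r.
Local Notation coord := (lattice_coord phi_range).
Hypothesis cE : forall i x, (xi x i)%:Z = lform (c i) (coord x).

Let semigroup_cone := semigroup_form_cone phi_inj sigma_support cE.
Let full := form_cone_full phi_inj sigma_support cE.
Let irr := support_irredundant sigma_support.
Let coprime : forall j, \big[gcdn/0%N]_(k < r) `|sigma j ord0 k|%N = 1%N.
Proof. by case: sigma_support. Qed.
Let coord_ge0 := form_coord_ge0 phi_inj sigma_support cE.
Let divides := mmul_divides phi_inj sigma_support cE.

Lemma coset_module_not_divisorial i : ('I_s : Type) ->
  (forall j (e : nat), ~ forall u : 'rV[int]_r,
     lform (c i) u = e%:Z * lform (sigma j) u) ->
  exists2 z : embedding_coset xi, exists q : coset_module K z, q <> 0 &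
    ~ divisorial_module (coset_module K z).
Proof.
move=> j0 not_mult.
have facet j : exists2 x, lform (sigma j) (coord x) = 0 & (0 < xi x i)%N.
  apply: contrapT => H.
  have [||e] := form_vanishing_on_facet coprime full irr (j0 := j) (c := c i).
  - by move=> u /semigroup_cone[x <-]; rewrite -cE.
  - move=> u /semigroup_cone[x <-] x0; rewrite -cE.
    by case: (posnP (xi x i)) => [->//|xi0]; case: H; exists x.
  exact: not_mult.
(* Exponents in this module are congruent to minus the i-th unit vector, so multiplying by the i-th
   variable identifies it with the ideal [xi_i > 0]. *)
have [z zE] : exists z : embedding_coset xi,
    coset_set z = [set exponent (ucm i) + g | g in embedding_gp xi].
  by exists (EmbeddingCoset (ex_intro _ (exponent (ucm i)) erefl)).
have zi x : coset_set z (exponent (ucm i) - exponent (xi x)).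
  rewrite zE; exists (- exponent (xi x)) => //; apply/embedding_gpP.
  exists (semigroup_zero S), x.
  have -> : xi (semigroup_zero S) = mone := embedding0 xi.
  by apply/rowP => k; rewrite !mxE cm1 add0r.
have shift b : coset_set z (- exponent b) ->
    exists t, mmul (ucm i) b = mmul mone (xi t).
  rewrite zE => -[_ /embedding_gpP[x [y ->]] e].
  have [|t ->] := @exponent_diff_pure m n S xi (mmul (ucm i) b) y x.
    by rewrite exponentM -[exponent b]opprK -e opprD opprB addrA subrr add0r.
  by exists t; rewrite mul1m.
have [theta [theta_inj theta_supp theta_onto]] := coset_module_form K shift.
have TP t : (0 < xi t i)%N -> shifted_coset z (ucm i) mone t.
  move=> ti; exists (divcm (xi t) (ucm i)).
    have -> : - exponent (divcm (xi t) (ucm i)) =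
        exponent (ucm i) - exponent (xi t).
      apply/rowP => k; rewrite !mxE divcmE.
      by rewrite ucmE; case: eqP => [<-|_]; lia.
    exact: zi.
  rewrite mul1m; apply/eqP/cmP => k; rewrite cmM divcmE ucmE.
  by case: eqP => [<-|_]; lia.
have T1 t : shifted_coset z (ucm i) mone t -> (0 < xi t i)%N.
  by move=> [b _]; rewrite mul1m => <-; rewrite cmM ucmE eqxx.
have [x0 _ /TP Px0] := facet j0.
exists z; first exact: (monomial_neq0 theta_onto Px0).
move=> [I [_ rI] iso]; have := reflexive_isomorphic iso rI.
apply: (monomial_ideal_not_reflexive theta_inj theta_supp theta_onto Px0).
  by move/T1; rewrite embedding0 cm1.
(* Testing with a monomial [u] of the ideal on the facet [j] costs nothing in [sigma j], so
   [sigma j] of [x / a] is nonnegative. *)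
move=> a x _ H; apply: divides => j.
have [u uj /TP/H[t /(congr1 coord)]] := facet j.
rewrite !(coordM phi_inj) => e.
have -> : coord x - coord a = coord t - coord u.
  apply/eqP; rewrite subr_eq addrAC eq_sym subr_eq.
  by rewrite [coord x + _]addrC e addrC.
by rewrite raddfB /= uj subr0 coord_ge0.
Qed.

Lemma coset_module_divisorial (z : embedding_coset xi) :
  (forall i, exists j (e : nat), forall u : 'rV[int]_r,
     lform (c i) u = e%:Z * lform (sigma j) u) ->
  (exists q : coset_module K z, q <> 0) ->
  divisorial_module (coset_module K z).
Proof.
move=> mult [q q0].
have [a0 za0] : exists a0, coset_set z (- exponent a0).
  have /fset0Pn[a aq] : msupp (val q : {mpoly K[n]}) != fset0.
    rewrite msupp_eq0; apply/eqP => vq0; apply: q0; exact: val_inj.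
  by exists a; exact: (set_mem (valP q)).
have [p p0] := cone_interior coprime full.
(* A large multiple [s0] of an interior point dominates [a0] wherever [c i] is nonzero, so
   multiplying by [xi s0 / a0] moves the coset into [xi(S)]. Where [c i] is zero, the i-th exponent
   is constant on the coset. *)
pose N := (\sum_i a0 i)%N.
have /semigroup_cone[s0 s0E] : form_cone sigma (p *+ N).
  by move=> j; rewrite raddfMn mulrn_wge0 // ltW //; exact: p0.
have s0_ge i :
    (forall u : 'rV[int]_r, lform (c i) u = 0) \/ (a0 i <= xi s0 i)%N.
  have [j [[|e] ce]] := mult i; [by left=> u; rewrite ce mul0r|right].
  have aN : (a0 i <= N)%N by rewrite /N (bigD1 i) //= leq_addr.
  have := p0 j; have := cE i s0; rewrite s0E ce raddfMn /=.
  move: aN; move: (xi s0 i) (a0 i) (lform _ p) (N) => x y l k kx.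
  by rewrite -mulr_natr natz; nia.
have shift b : coset_set z (- exponent b) ->
    exists t, mmul (xi s0) b = mmul a0 (xi t).
  move=> zb; have [x [y e]] := coset_sub zb za0.
  pose u := coord x - coord y + coord s0.
  have cu i : lform (c i) u = (b i)%:Z - (a0 i)%:Z + (xi s0 i)%:Z.
    rewrite /u raddfD raddfB /= -!cE; congr (_ + _).
    by have /rowP/(_ i) := e; rewrite !mxE => <-; rewrite opprK addrC.
  have [i|t tu] := (semigroup_embedding_cone phi_inj cE u).2.
    case: (s0_ge i) => [->//|]; rewrite cu; lia.
  exists t; apply/eqP/cmP => i; rewrite !cmM.
  by have := cE i t; rewrite tu cu; lia.
have [theta [theta_inj theta_supp theta_onto]] := coset_module_form K shift.
have TP t : (forall i, xi s0 i <= a0 i + xi t i)%N ->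
    shifted_coset z (xi s0) a0 t.
  move=> tP; exists (divcm (mmul a0 (xi t)) (xi s0)).
    have -> : - exponent (divcm (mmul a0 (xi t)) (xi s0)) =
        - exponent a0 + (exponent (xi s0) - exponent (xi t)).
      by apply/rowP => k; rewrite !mxE divcmE cmM; have := tP k; lia.
    exact: coset_add.
  apply/eqP/cmP => k; rewrite !cmM divcmE cmM; have := tP k; lia.
have Ts0 : shifted_coset z (xi s0) a0 s0 by apply: TP => i; exact: leq_addl.
apply: (rank_one_divisorial theta_inj); first by exists q.
apply: (monomial_ideal_reflexive theta_inj theta_supp theta_onto Ts0) => x nTx.
have [i xi_lt] : exists i, (a0 i + xi x i < xi s0 i)%N.
  apply: contrapT => H; apply/nTx/TP => i; rewrite leqNgt; apply/negP => lt.
  by apply: H; exists i.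
have [j [e ce]] := mult i.
(* The minimum of [sigma j] on the ideal is the sharp bound for the violated inequality. *)
have [t0 Tt0 t0_min] : exists2 t0, shifted_coset z (xi s0) a0 t0 &
    forall t, shifted_coset z (xi s0) a0 t ->
      lform (sigma j) (coord t0) <= lform (sigma j) (coord t).
  pose Q k := `[< exists2 t, shifted_coset z (xi s0) a0 t &
                 lform (sigma j) (coord t) = k%:Z >].
  have /ex_minnP[k /asboolP[t0 Tt0 t0k] kmin] : exists k, Q k.
    exists `|lform (sigma j) (coord s0)|%N; apply/asboolP; exists s0 => //.
    by rewrite gez0_abs // coord_ge0.
  exists t0 => // t Tt; rewrite t0k -[leRHS]gez0_abs ?coord_ge0 // lez_nat.
  apply: kmin; apply/asboolP; exists t => //.
  by rewrite gez0_abs // coord_ge0.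
(* The separating fraction [g / h] has [sigma j] equal to minus that minimum; a multiple of [v], on
   which [sigma j] vanishes, makes all other forms nonnegative. *)
have [v [v0 v1]] := facet_interior coprime full irr j.
have [w wj] := support_form_onto coprime j (- lform (sigma j) (coord t0)).
have [L wL] := facet_translate w v1.
have [g [h gh]] := coord_gp phi_inj phi_range (w + v *+ L).
have ghj : lform (sigma j) (coord g) - lform (sigma j) (coord h) =
    - lform (sigma j) (coord t0).
  by rewrite -raddfB -gh raddfD raddfMn /= v0 mul0rn addr0.
exists g, h; split=> [t Tt|[t' e']].
  apply: divides => k; rewrite (coordM phi_inj) raddfB raddfD /=.
  have [->|kj] := eqVneq k j.
    by rewrite addrAC ghj addrC subr_ge0 t0_min.
  by rewrite addrAC -raddfB -gh addr_ge0 ?wL.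
have := congr1 (fun t => lform (sigma j) (coord t)) e'.
rewrite /= !(coordM phi_inj) !raddfD /= => e2.
have xt0 : lform (sigma j) (coord t0) <= lform (sigma j) (coord x).
  have <- : lform (sigma j) (coord t') + lform (sigma j) (coord t0) =
      lform (sigma j) (coord x).
    rewrite -[lform _ (coord t0)]opprK -ghj opprB addrCA addrA -e2.
    by rewrite addrC addKr.
  by rewrite lerDr coord_ge0.
(* As [xi_i] is a nonnegative multiple of [sigma j], [x] would satisfy the i-th inequality because
   [t0] does. *)
have [b _ /(congr1 (fun a : 'X_{1..n} => a i))] := Tt0; rewrite !cmM => e3.
have : (xi t0 i)%:Z <= (xi x i)%:Z by rewrite !cE !ce ler_wpM2l.
by rewrite lez_nat; lia.
Qed.

End Directions.

Theorem proposition2p4 (RR : realType) (K : fieldType) (m r n s : nat)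
    (S : posAffineSemigroup m) (xi : pureEmbedding n S)
    (phi : {additive 'rV[int]_r -> 'rV[int]_m}) (sigma : 'I_s -> 'rV[int]_r) :
  semigroup_set S <> [set 0] ->
  normal_semigroup S ->
  injective phi -> range phi = gp S ->
  support_forms RR S phi sigma ->
  (forall z : embedding_coset xi,
     (exists q : coset_module K z, q <> 0) ->
     divisorial_module (coset_module K z))
  <->
  (forall i : 'I_n, exists (j : 'I_s) (e : nat),
     forall (x y : semigroup_elt S) (u : 'rV[int]_r), phi u = val x - val y ->
       (xi x i)%:Z - (xi y i)%:Z = e%:Z * lform (sigma j) u).
Proof.
move=> Sn0 _ phi_inj phi_range supp.
have [c cE] := embedding_forms xi phi_inj phi_range.
have [j0 _] := support_form_exists phi_inj supp cE Sn0.
have cdiff i x y u : phi u = val x - val y ->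
    (xi x i)%:Z - (xi y i)%:Z = lform (c i) u.
  by move/(coord_diff phi_inj phi_range) => ->; rewrite raddfB /= -!cE.
split=> [div i|mult z qz].
  apply: contrapT => H.
  have [|z qz] := coset_module_not_divisorial K phi_inj supp cE j0 (i := i).
    move=> j e ce.
    by apply: H; exists j, e => x y u /cdiff->.
  by apply; exact: div.
apply: (coset_module_divisorial phi_inj supp cE _ qz) => i.
have [j [e ce]] := mult i; exists j, e => u.
by have [x [y xyu]] := diff_phi phi_range u; rewrite -(cdiff i _ _ _ xyu); exact: ce.
Qed.
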